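(* For every real Banach space $X$, $A_B(X)=A_2(X)$, where $$A_B(X)=\sup_{(x,y,\beta)\in\mathcal R_B(X)}\frac{\|x\|+\|\beta x+y\|}{r(x,y,\beta)},\qquad A_2(X)=\sup\left\{\frac{\|u+v\|+\|u-v\|}{2}: u,v\in S_X\right\}.$$
   Context: $S_X=\{x\in X:\|x\|=1\}$. Birkhoff-James orthogonality: $x\perp_B y$ means $\|x+ty\|\ge\|x\|$ for all $t\in\mathbb{R}$. $\mathcal R_B(X)$ is the set of all triples $(x,y,\beta)\in X\times X\times\mathbb{R}$ such that $x\neq0$, $x\perp_B y$, and $0<\|(1+\beta)x+y\|=\|(1-\beta)x-y\|$. For $(x,y,\beta)\in\mathcal R_B(X)$, $r(x,y,\beta)=\|(1+\beta)x+y\|=\|(1-\beta)x-y\|$. *)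

(* Defs.v *)
From HB Require Import structures.
From mathcomp Require Import all_boot all_order all_algebra.
From mathcomp Require Import all_classical all_reals all_analysis.

Set Implicit Arguments.
Unset Strict Implicit.
Unset Printing Implicit Defensive.

Import Order.TTheory GRing.Theory Num.Theory.
Import numFieldNormedType.Exports.

Local Open Scope classical_set_scope.
Local Open Scope ring_scope.

Section BirkhoffJames.
Context {R : realType} (X : normedModType R).

Definition unit_sphere : set X := [set x | `|x| = 1].

Definition bj_orthogonal (x y : X) : Prop :=
  forall t : R, `|x| <= `|x + t *: y|.

Definition bj_triples : set (X * X * R) :=
  [set p | let: (x, y, beta) := p in
    [/\ x != 0, bj_orthogonal x y,
        0 < `|(1 + beta) *: x + y| &
        `|(1 + beta) *: x + y| = `|(1 - beta) *: x - y| ] ].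

(* On bj_triples this is also `|(1 - beta) *: x - y|. *)
Definition bj_radius (p : X * X * R) : R :=
  let: (x, y, beta) := p in `|(1 + beta) *: x + y|.

(* Suprema are in \bar R: the real-valued sup has a default value on unbounded
   sets. For X = 0 both index sets are empty and both suprema are -oo. *)
Definition A_B : \bar R :=
  ereal_sup [set ((let: (x, y, beta) := p in `|x| + `|beta *: x + y|)
                  / bj_radius p)%:E | p in bj_triples].

Definition A_2 : \bar R :=
  ereal_sup [set ((`|p.1 + p.2| + `|p.1 - p.2|) / 2)%:E
            | p in unit_sphere `*` unit_sphere].

End BirkhoffJames.

(* Main.v *)
(** Writing [x = (u + v) / 2] and [z = (u - v) / 2], a pair [u, v] of unit
    vectors with [u + v != 0] is the same thing, up to the scale [r], as a
    triple [(x, z - beta x, beta)], provided [beta] makes [x] orthogonal to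
    [z - beta x]. Such a [beta] exists by the one-dimensional Hahn-Banach
    extension step for the functional [x |-> `|x|]. If [u + v = 0], the value
    is [1], attained at the triple [(u, 0, 0)]. *)
Require Import Defs.
From mathcomp Require Import all_boot all_order all_algebra.
From mathcomp Require Import all_classical all_reals all_analysis.
From mathcomp Require Import ring lra.

Import Order.TTheory GRing.Theory Num.Theory.
Import numFieldNormedType.Exports.

Local Open Scope classical_set_scope.
Local Open Scope ring_scope.

(** [b] is the value at [z] of a functional of norm at most 1 on the span of [x] and [z] that sends
    [x] to its norm. Only the coefficients -1 and 1 of [z] are tested; homogeneity gives the
    others. *)
Lemma ex_norm_extension (R : realType) (X : normedModType R) (x z : X) :
  exists b : R, forall a, a * `|x| - b <= `|a *: x - z| /\
                          a * `|x| + b <= `|a *: x + z|.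
Proof.
pose E := [set a * `|x| - `|a *: x - z| | a in [set: R]].
(* Each lower bound for [b] lies below each upper bound: this is the triangle inequality for [(c *:
   x - z) + (a *: x + z) = (c + a) *: x]. *)
have ubE a : ubound E (`|a *: x + z| - a * `|x|).
  move=> _ [c _ <-].
  have := ler_normD (c *: x - z) (a *: x + z).
  rewrite addrACA addNr addr0 -scalerDl normrZ.
  have := ler_wpM2r (normr_ge0 x) (ler_norm (c + a)).
  rewrite mulrDl; lra.
have E0 : E !=set0 by exists (0 * `|x| - `|0 *: x - z|), 0.
exists (sup E) => a; split.
  have : a * `|x| - `|a *: x - z| <= sup E.
    by apply: ub_le_sup; [exists (`|0 *: x + z| - 0 * `|x|)|exists a].
  lra.
have := ge_sup E0 (ubE a); lra.
Qed.

(** With [beta] equal to [b] over the norm of [x], the vector [z - beta *: x] lies in the kernel of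
    the extended functional, so adding multiples of it to [x] cannot lower the norm. *)
Lemma ex_bj_orthogonal (R : realType) (X : normedModType R) (x z : X) :
  x != 0 -> exists beta : R, bj_orthogonal x (z - beta *: x).
Proof.
move=> x0; have nx0 : `|x| != 0 by rewrite normr_eq0.
have [b hb] := ex_norm_extension _ _ x z; exists (b / `|x|) => t.
set c := 1 - t * (b / `|x|).
have -> : x + t *: (z - (b / `|x|) *: x) = c *: x + t *: z.
  by rewrite scalerBr scalerA /c scalerBl scale1r addrA addrAC.
(* The right-hand side is the functional at [c *: x + t *: z]. Dividing by the absolute value of [t]
   makes the coefficient of [z] equal to 1 or -1, hence the split on the sign of [t]. *)
have hc : `|x| = c * `|x| + t * b by rewrite /c; field.
have [t0|t0|t0] := ltgtP t 0.
- have -> : c *: x + t *: z = (- t) *: ((c / - t) *: x - z).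
    rewrite scalerBr scalerA scaleNr opprK mulrC divfK //.
    by rewrite oppr_eq0 lt_eqF.
  rewrite normrZ gtr0_norm ?oppr_gt0// {1}hc.
  have [h _] := hb (c / - t).
  have mt : 0 <= - t by lra.
  apply: le_trans (ler_wpM2l mt h).
  suff -> : - t * (c / - t * `|x| - b) = c * `|x| + t * b by [].
  by field; rewrite lt_eqF.
- have -> : c *: x + t *: z = t *: ((c / t) *: x + z).
    by rewrite scalerDr scalerA mulrC divfK // gt_eqF.
  rewrite normrZ gtr0_norm // {1}hc.
  have [_ h] := hb (c / t).
  apply: le_trans (ler_wpM2l (ltW t0) h).
  suff -> : t * (c / t * `|x| + b) = c * `|x| + t * b by [].
  by field; rewrite gt_eqF.
- by rewrite /c t0 mul0r subr0 scale1r scale0r addr0.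
Qed.

(** Dividing the two vectors of norm [r] by [r] gives unit vectors with sum [(2 / r) *: x] and
    difference [(2 / r) *: (beta *: x + y)]. *)
Lemma A_B_le_A_2 (R : realType) (X : normedModType R) : (A_B X <= A_2 X)%E.
Proof.
apply: ub_ereal_sup => _ [[[x y] beta] [x0 xy r0 req] <-].
rewrite /bj_radius; set r := `|(1 + beta) *: x + y| in r0 req *.
have unitr (w : X) : r = `|w| -> `|r^-1 *: w| = 1.
  by move=> rw; rewrite normrZ ger0_norm ?invr_ge0 ?ltW// -rw mulVf// gt_eqF.
apply: ereal_sup_ubound.
exists (r^-1 *: ((1 + beta) *: x + y), r^-1 *: ((1 - beta) *: x - y)).
  by split; apply: unitr.
congr (_%:E) => /=; rewrite -scalerDr -scalerBr.
have -> : (1 + beta) *: x + y = x + (beta *: x + y).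
  by rewrite scalerDl scale1r addrA.
have -> : (1 - beta) *: x - y = x - (beta *: x + y).
  by rewrite scalerBl scale1r opprD addrA.
set b := beta *: x + y.
have -> : x + b + (x - b) = 2 *: x by rewrite addrACA subrr addr0 scaler_nat.
have -> : x + b - (x - b) = 2 *: b.
  by rewrite opprB addrC addrA subrK scaler_nat.
rewrite !normrZ ger0_norm ?invr_ge0 ?(ltW r0)// [`|2|]ger0_norm//.
by field; rewrite gt_eqF.
Qed.

Lemma A_2_le_A_B (R : realType) (X : normedModType R) : (A_2 X <= A_B X)%E.
Proof.
apply: ub_ereal_sup => _ [[u v] [/= u1 v1] <-]; rewrite /unit_sphere/= in u1 v1.
apply: ereal_sup_ubound.
have half (w : X) : 2^-1 *: w + 2^-1 *: w = w.
  by rewrite -scalerDl -[RHS]scale1r; congr (_ *: _); field.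
have [uv|uv] := eqVneq (u + v) 0.
  have vE : v = - u by apply/eqP; rewrite -addr_eq0 addrC uv.
  have u0 : u != 0 by rewrite -normr_gt0 u1.
  exists (u, 0, 0).
    split => //; rewrite ?addr0 ?subr0 ?scale1r ?u1//.
    by move=> t; rewrite scaler0 addr0.
  congr (_%:E); rewrite /bj_radius vE subrr opprK scale0r !addr0 scale1r.
  by rewrite normr0 u1 -mulr2n -scaler_nat normrZ u1 ger0_norm//; field.
pose x := 2^-1 *: (u + v); pose z := 2^-1 *: (u - v).
have x0 : x != 0 by rewrite scaler_eq0 negb_or uv andbT invr_eq0.
have [beta xz] := ex_bj_orthogonal _ _ _ z x0.
have eu : (1 + beta) *: x + (z - beta *: x) = u.
  rewrite scalerDl scale1r addrACA subrr addr0 -scalerDr addrACA subrr addr0.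
  by rewrite scalerDr half.
have ev : (1 - beta) *: x - (z - beta *: x) = v.
  rewrite scalerBl scale1r opprB addrA subrK -scalerBr opprB addrC addrA subrK.
  by rewrite scalerDr half.
(* The two vectors of this triple are [u] and [v] themselves, so its radius is 1, and
   [beta *: x + y] is [z]. *)
exists (x, z - beta *: x, beta).
  by split; rewrite ?eu ?ev ?u1 ?v1.
congr (_%:E); rewrite /bj_radius eu u1 divr1 addrCA subrr addr0.
by rewrite !normrZ -mulrDr mulrC ger0_norm// invr_ge0.
Qed.

Theorem theorem4p7 (R : realType) (X : completeNormedModType R) :
  A_B X = A_2 X.
Proof.
by apply/le_anti/andP; split; [exact: A_B_le_A_2|exact: A_2_le_A_B].
Qed.
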